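(* Let $k$ be a field, let $n\ge 0$, and let $\mathscr{A}$ be a finite set of $k$-rational points of $\mathbb{P}^n$ (coordinates $X_1,\ldots,X_{n+1}$). Let $\leq$ be a term order on $k[X_1,\ldots,X_{n+1}]$ with $X_1<\ldots<X_{n+1}$ and let $\preceq$ be the associated graded order. Then for all $j\in\{1,\ldots,n+1\}$, the set $\mathscr{D}(\mathscr{A})\subset\mathbb{N}^{n+1}$ contains precisely $\#D(A_j)$ axes parallel to $\mathbb{N}e_j$. These are the images, under the embedding $\mathbb{N}^{n+2-j}\hookrightarrow\mathbb{N}^{n+1}$, $(\gamma_j,\ldots,\gamma_{n+1})\mapsto(0,\ldots,0,\gamma_j,\ldots,\gamma_{n+1})$, of the axes contained in $\mathscr{D}(\langle A_j\rangle)\subset\mathbb{N}^{n+2-j}$.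
   Context: $\mathbb{N}$ contains $0$; $|\gamma|$ is the sum of the components of $\gamma$; $e_i$ is the $i$-th standard basis vector. A term order on exponents/monomials is a total order compatible with multiplication and with $1$ as smallest element. The graded order $\preceq$ associated to $\leq$ is: $X^\gamma\prec X^\delta$ iff $|\gamma|<|\delta|$, or $|\gamma|=|\delta|$ and $X^\gamma<X^\delta$. Points of projective space are viewed as lines through $0$ in affine space. The vanishing ideal $\mathscr{I}(\mathscr{A})\subset k[X_1,\ldots,X_{n+1}]$ of $\mathscr{A}$ is the homogeneous ideal of all polynomials $f$ vanishing on all these lines, i.e. such that $f(ta_1,\ldots,ta_{n+1})=0$ in $k[t]$ for every $[a_1:\ldots:a_{n+1}]\in\mathscr{A}$. $\mathscr{C}(\mathscr{A})\subset\mathbb{N}^{n+1}$ is the set of leading exponents w.r.t. $\preceq$ of nonzero elements of $\mathscr{I}(\mathscr{A})$, and $\mathscr{D}(\mathscr{A})=\mathbb{N}^{n+1}\setminus\mathscr{C}(\mathscr{A})$. For $j\in\{1,\ldots,n+1\}$, $A_j$ is the set of points of $\mathscr{A}$ having a representative with $X_1=\ldots=X_{j-1}=0$ and $X_j=1$, regarded as a finite subset of $\mathbb{A}^{n+1-j}(k)=k^{n+1-j}$ with coordinates $X_{j+1},\ldots,X_{n+1}$. $I(A_j)\subset k[X_{j+1},\ldots,X_{n+1}]$ is the ideal of polynomials vanishing on $A_j$, and $D(A_j)\subset\mathbb{N}^{n+1-j}$ is the complement of the set of leading exponents, w.r.t. the order induced by $\leq$, of nonzero elements of $I(A_j)$.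 $\langle A_j\rangle$ denotes the set of lines through $0$ and the points of $A_j$, regarded as a finite set of points $[1:a_{j+1}:\ldots:a_{n+1}]$ of the projective space $\mathbb{P}^{n+1-j}$ with coordinates $X_j,\ldots,X_{n+1}$; $\mathscr{D}(\langle A_j\rangle)\subset\mathbb{N}^{n+2-j}$ is the complement of the set of leading exponents (w.r.t. the order induced by $\preceq$ on $k[X_j,\ldots,X_{n+1}]$) of nonzero elements of its vanishing ideal in $k[X_j,\ldots,X_{n+1}]$, with exponents indexed as $(\gamma_j,\ldots,\gamma_{n+1})$. An axis in $\mathbb{N}^{m}$ is a set of the form $\gamma+\mathbb{N}e_i$ with $\gamma\in\mathbb{N}^m$, $\gamma_i=0$; such an axis is called parallel to $\mathbb{N}e_i$. *)

(* Defs.v *)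
From mathcomp Require Import all_boot all_order all_algebra.
From mathcomp Require Import mpoly.
From mathcomp Require Import boolp classical_sets functions cardinality.

Set Implicit Arguments.
Unset Strict Implicit.
Unset Printing Implicit Defensive.

Import GRing.Theory.

Local Open Scope classical_set_scope.
Local Open Scope ring_scope.

(* Indices are 0-based throughout: the variable X_i is 'X_(i-1). *)

(* A relation on exponents is the same thing as a relation on monomials. *)
Record term_order (m : nat) (le : rel 'X_{1..m}) : Prop := TermOrder {
  term_order_refl : reflexive le;
  term_order_anti : antisymmetric le;
  term_order_trans : transitive le;
  term_order_total : total le;
  term_order_mul : forall a b c, le a b -> le (a + c)%MM (b + c)%MM;
  term_order_one : forall a, le 0%MM a
}.

Definition strict (m : nat) (le : rel 'X_{1..m}) : rel 'X_{1..m} :=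
  fun a b => (a != b) && le a b.

Definition graded (m : nat) (le : rel 'X_{1..m}) : rel 'X_{1..m} :=
  fun a b => (mdeg a < mdeg b)%N || (mdeg a == mdeg b) && le a b.

Definition is_lead_exp (k : fieldType) (m : nat) (le : rel 'X_{1..m})
    (f : {mpoly k[m]}) (g : 'X_{1..m}) : Prop :=
  g \in msupp f /\ (forall h, h \in msupp f -> le h g).

Definition lead_exps (k : fieldType) (m : nat) (le : rel 'X_{1..m})
    (I : set {mpoly k[m]}) : set 'X_{1..m} :=
  [set g | exists f, [/\ I f, f != 0 & is_lead_exp le f g]].

Definition std_exps (k : fieldType) (m : nat) (le : rel 'X_{1..m})
    (I : set {mpoly k[m]}) : set 'X_{1..m} :=
  ~` lead_exps le I.

(* The k-rational points of P^n, as lines through 0 in k^(n+1). *)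
Definition proj (k : fieldType) (n : nat) : Type :=
  {L : {vspace 'rV[k]_n.+1} | \dim L == 1%N}.

(* P = [a_1 : ... : a_(n+1)] *)
Definition represents (k : fieldType) (n : nat) (a : 'rV[k]_n.+1)
    (P : proj k n) : Prop :=
  a != 0 /\ a \in val P.

(* [mmap] below computes f(t a_1, ..., t a_(n+1)) in k[t]. *)
Definition proj_ideal (k : fieldType) (n : nat) (A : set (proj k n)) :
    set {mpoly k[n.+1]} :=
  [set f | forall P a, A P -> represents a P ->
     mmap (@polyC k) (fun i => a 0 i *: 'X) f = 0].

Definition aff_ideal (k : fieldType) (m : nat) (B : set 'rV[k]_m) :
    set {mpoly k[m]} :=
  [set f | forall b, B b -> f.@[fun i => b 0 i] = 0].

(* (v_0, ..., v_(n-j)) |-> (0, ..., 0, v_0, ..., v_(n-j)), with j zeros. *)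
Definition pad (V : nmodType) (n : nat) (j : 'I_n.+1)
    (v : 'I_(n - j).+1 -> V) : 'I_n.+1 -> V :=
  fun i => if (i < j)%N then 0 else v (inord (i - j)).

Definition row_pad (k : fieldType) (n : nat) (j : 'I_n.+1)
    (v : 'rV[k]_(n - j).+1) : 'rV[k]_n.+1 :=
  \row_i pad (fun l => v 0 l) i.

Definition exp_pad (n : nat) (j : 'I_n.+1) (g : 'X_{1..(n - j).+1}) :
    'X_{1..n.+1} :=
  [multinom pad (fun l => g l) i | i < n.+1].

Definition exp_cons0 (m : nat) (g : 'X_{1..m}) : 'X_{1..m.+1} :=
  [multinom oapp (fun l => g l) 0%N (unlift ord0 i) | i < m.+1].

(* (b_1, ..., b_m) |-> (1, b_1, ..., b_m) *)
Definition cons1 (k : fieldType) (m : nat) (b : 'rV[k]_m) : 'rV[k]_m.+1 :=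
  row_mx 1%:M b.

(* The order induced on the exponents of k[X_j, ..., X_(n+1)]. *)
Definition induced_from (n : nat) (j : 'I_n.+1) (le : rel 'X_{1..n.+1}) :
    rel 'X_{1..(n - j).+1} :=
  relpre (@exp_pad n j) le.

Arguments induced_from {n} j le.

(* The order induced on the exponents of k[X_(j+1), ..., X_(n+1)]. *)
Definition induced_after (n : nat) (j : 'I_n.+1) (le : rel 'X_{1..n.+1}) :
    rel 'X_{1..n - j} :=
  relpre (@exp_cons0 (n - j)) (induced_from j le).

Arguments induced_after {n} j le.

(* The points of A whose first nonzero coordinate is the j-th one, in the affine
   coordinates that follow it. *)
Definition chart (k : fieldType) (n : nat) (A : set (proj k n))
    (j : 'I_n.+1) : set 'rV[k]_(n - j) :=
  [set b | exists2 P, A P & represents (row_pad (cons1 b)) P].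

Arguments chart {k n} A j.

(* The points [1 : b], b in B, i.e. the lines through 0 and the (1, b). *)
Definition lines_through (k : fieldType) (m : nat) (B : set 'rV[k]_m) :
    set (proj k m) :=
  [set P | exists2 b, B b & represents (cons1 b) P].

Definition axis (m : nat) (i : 'I_m) (g : 'X_{1..m}) : set 'X_{1..m} :=
  [set (g + U_(i) *+ t)%MM | t in [set: nat]].

Definition is_axis_along (m : nat) (i : 'I_m) (S : set 'X_{1..m}) : Prop :=
  exists2 g : 'X_{1..m}, g i = 0%N & S = axis i g.

Definition axes_along (m : nat) (i : 'I_m) (D : set 'X_{1..m}) :
    set (set 'X_{1..m}) :=
  [set S | is_axis_along i S /\ S `<=` D].

Definition axes (m : nat) (D : set 'X_{1..m}) : set (set 'X_{1..m}) :=
  [set S | (exists i, is_axis_along i S) /\ S `<=` D].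

(* Main.v *)
Require Import Defs.
From HB Require Import structures.
From mathcomp Require Import all_boot all_order all_algebra.
From mathcomp Require Import mpoly.
From mathcomp Require Import zify.
From mathcomp Require Import boolp classical_sets functions cardinality.

Set Implicit Arguments.
Unset Strict Implicit.
Unset Printing Implicit Defensive.

Import GRing.Theory.

Local Open Scope classical_set_scope.
Local Open Scope card_scope.
Local Open Scope ring_scope.

(** The leading exponents of a homogeneous vanishing ideal can be tested degree by
    degree: an exponent g is leading for the graded order iff it is the leading
    exponent, for the ungraded order, of a form of degree |g| vanishing at all
    representatives of the points ([lead_exps_graded]).  Everything then rests on
    one kind of form: since X_i < X_j for i < j, the product of the X_j - c X_i,
    with c running over the finitely many ratios a_j / a_i taken by the points
    with a_i <> 0, has leading exponent a multiple of e_j and vanishes at all of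
    those points ([ratio_form]).

    Which axes parallel to e_j are contained in D(A)?

    - If g_i > 0 for some i < j, then X_i times such a product vanishes on all of
      A, so g + t e_j is a leading exponent for large t
      ([proj_lead_earlier]): only axes padded from the last coordinates remain.
    - For a padded exponent, restricting a form to X_i = 0 for i < j keeps its
      leading exponent and gives a form vanishing on the lines through A_j
      ([proj_lead_unpad]).  Conversely, a form vanishing on these lines becomes a
      form vanishing on A after multiplication by X_j, which kills the points whose
      j-th coordinate is zero, and by ratio forms, which kill the points with an
      earlier nonzero coordinate; this only adds a multiple of e_j to the leading
      exponent ([proj_lead_pad]).  Hence the axes parallel to e_j in D(A) are the
      padded axes parallel to the first coordinate direction in D(<A_j>), and
      ratio forms again show that D(<A_j>) contains no axis in another direction
      ([proj_lead_lines_other]).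
    - Setting X_j = 1, respectively homogenising with X_j, identifies the axes in
      D(<A_j>) with the standard exponents of the affine ideal I(A_j)
      ([proj_lead_lines]).

    The last identification does not use the order induced by <= on the affine
    exponents: homogenising need not respect that order.  It uses the order
    [dehom_le], which compares two exponents after they have been brought to the
    same degree with the smallest variable X_j.  The two orders may give different
    sets of standard exponents, but both sets have #A_j elements: for every term
    order the standard monomials restrict to a basis of the functions on a finite
    set of points ([card_std_exps_aff]).  This gives the number of axes. *)

(** * Term orders and leading exponents *)

Lemma mulmnD (m : nat) (a : 'X_{1..m}) s t : (a *+ (s + t) = a *+ s + a *+ t)%MM.
Proof. by apply/mnmP => i; rewrite mnmDE !mulmnE mulnDr. Qed.

Section TermOrders.
Context (m : nat) (le : rel 'X_{1..m}) (leT : term_order le).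
Implicit Types a b c d : 'X_{1..m}.

Lemma term_order_eq a b : le a b -> le b a -> a = b.
Proof. by move=> ab ba; apply: (term_order_anti leT); rewrite ab ba. Qed.

Lemma term_order_le_trans b a c : le a b -> le b c -> le a c.
Proof. exact: (term_order_trans leT). Qed.

Lemma term_order_add a b c d : le a b -> le c d -> le (a + c)%MM (b + d)%MM.
Proof.
move=> ab cd; apply: (term_order_le_trans (term_order_mul leT c ab)).
by rewrite ![(b + _)%MM]addmC; apply: (term_order_mul leT).
Qed.

(** Compatibility with addition is only assumed in one direction; totality
    turns it into an equivalence. *)
Lemma term_order_cancel c a b : le (a + c)%MM (b + c)%MM -> le a b.
Proof.
move=> abc; have [//|ba] := orP (term_order_total leT a b).
have /addIm -> := term_order_eq abc (term_order_mul leT c ba).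
exact: (term_order_refl leT).
Qed.

Lemma term_order_addr a b : le a (a + b)%MM.
Proof.
rewrite -{1}[a]addm0; apply: term_order_add; first exact: (term_order_refl leT).
exact: (term_order_one leT).
Qed.

Lemma strictE a b : strict le a b = ~~ le b a.
Proof.
rewrite /strict; case: (orP (term_order_total leT a b)) => lab.
  rewrite lab andbT; apply/idP/idP; last first.
    by apply: contraNneq => ->; rewrite (term_order_refl leT).
  by apply: contraNN => lba; rewrite (term_order_eq lab lba).
rewrite lab /=; apply/negbTE/negP => /andP[+ l2].
by rewrite (term_order_eq lab l2) eqxx.
Qed.

Lemma le_strict_trans b a c : le a b -> strict le b c -> strict le a c.
Proof.
by rewrite !strictE => ab ncb; apply: contraNN ncb => ca; apply: term_order_le_trans ab.
Qed.

Context (k : fieldType).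
Implicit Types f : {mpoly k[m]}.

Lemma is_lead_exp_neq0 f a : is_lead_exp le f a -> f != 0.
Proof. by case=> + _; apply: contraTneq => ->; rewrite msupp0. Qed.

Lemma is_lead_exp_mpolyX a : is_lead_exp le ('X_[a] : {mpoly k[m]}) a.
Proof.
split=> [|b]; rewrite msuppX inE // => /eqP ->; exact: (term_order_refl leT).
Qed.

(** No cancellation can occur at [a1 + a2]: if [b1 + b2] is the same exponent,
    with [b1] and [b2] in the two supports, then [b1 <= a1] and [b2 <= a2] force
    equality in both places. *)
Lemma is_lead_exp_mul f1 f2 a1 a2 :
  is_lead_exp le f1 a1 -> is_lead_exp le f2 a2 ->
  is_lead_exp le (f1 * f2) (a1 + a2)%MM.
Proof.
move=> [s1 l1] [s2 l2]; split; last first.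
  move=> b /msuppM_le /allpairsP[[b1 b2] /= [/l1 h1 /l2 h2 ->]].
  exact: term_order_add.
have d1 : (mdeg a1 < (mdeg (a1 + a2)%MM).+1)%N by rewrite mdegD ltnS leq_addr.
have d2 : (mdeg a2 < (mdeg (a1 + a2)%MM).+1)%N by rewrite mdegD ltnS leq_addl.
rewrite mcoeff_msupp mcoeffM.
rewrite (bigD1 (BMultinom d1, BMultinom d2)) //= big1 => [|[[b1 e1] [b2 e2]]] /=.
  by rewrite addr0 mulf_neq0 -?mcoeff_msupp.
move=> /andP[/eqP E ne]; apply/eqP; rewrite mulf_eq0.
apply: contraNT ne; rewrite negb_or -!mcoeff_msupp => /andP[/l1 h1 /l2 h2].
have E1 : a1 = b1.
  apply: term_order_eq h1; apply: (@term_order_cancel a2).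
  by rewrite E; rewrite ![(b1 + _)%MM]addmC; apply: (term_order_mul leT).
have E2 : a2 = b2 by move: E; rewrite E1 => /addmI.
by rewrite xpair_eqE -!val_eqE /= E1 E2 !eqxx.
Qed.

End TermOrders.

Lemma term_order_relpre (m m' : nat) (phi : 'X_{1..m} -> 'X_{1..m'})
    (le : rel 'X_{1..m'}) :
    {morph phi : a b / (a + b)%MM >-> (a + b)%MM} -> injective phi ->
  term_order le -> term_order (relpre phi le).
Proof.
move=> phiD inj leT.
have phi0 : phi 0%MM = 0%MM.
  by apply: (@addmI _ (phi 0%MM)); rewrite -phiD !addm0.
split=> [a|a b|b a c|a b|a b c|a] /=.
- exact: (term_order_refl leT).
- by case/andP => ab ba; apply: inj; apply: (term_order_eq leT).
- exact: (term_order_trans leT).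
- exact: (term_order_total leT).
- by rewrite !phiD; apply: (term_order_mul leT).
- by rewrite phi0; apply: (term_order_one leT).
Qed.

(** * Standard exponents of a finite set of points *)

Section Counting.
Context (k : fieldType) (m : nat) (le : rel 'X_{1..m}) (leT : term_order le).
Context (N : nat) (p : 'I_N -> 'rV[k]_m).
Implicit Types (f : {mpoly k[m]}) (a b : 'X_{1..m}).

Definition eval_points f : 'rV[k]_N := \row_i f.@[fun l => p i 0 l].

Definition eval_exp a : 'rV[k]_N := eval_points 'X_[a].

Lemma eval_points_is_linear : linear eval_points.
Proof. by move=> c f g; apply/rowP=> i; rewrite !mxE mevalD mevalZ. Qed.

HB.instance Definition _ :=
  GRing.isLinear.Build k {mpoly k[m]} 'rV[k]_N _ eval_points
    eval_points_is_linear.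

Lemma eval_pointsE f :
  eval_points f = \sum_(a <- msupp f) f@_a *: eval_exp a.
Proof.
by rewrite {1}[f]mpolyE linear_sum /=; apply: eq_bigr => a _; rewrite linearZ.
Qed.

Lemma eval_points_span f :
  eval_points f \in <<[seq eval_exp a | a <- msupp f]>>%VS.
Proof.
rewrite eval_pointsE big_seq; apply: rpred_sum => a fa.
by apply: rpredZ; apply: memv_span; apply: map_f.
Qed.

Lemma span_eval_exp (s : seq 'X_{1..m}) v :
  v \in <<[seq eval_exp a | a <- s]>>%VS ->
  exists2 f, {subset msupp f <= s} & eval_points f = v.
Proof.
elim: s v => [|a s IH] v /=.
  rewrite span_nil memv0 => /eqP ->; exists 0; last by rewrite linear0.
  by move=> a; rewrite msupp0.
rewrite span_cons => /memv_addP[u /vlineP[c ->] [w /IH[f fs <-] ->]].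
exists (c *: 'X_[a] + f); last by rewrite linearD linearZ.
move=> b /msuppD_le; rewrite mem_cat inE => /orP[/msuppZ_le|/fs ->].
  by rewrite msuppX inE => ->.
by rewrite orbT.
Qed.

(** A finite set of exponents that suffices to span the functions on the points:
    in degree greater than [m * N] some variable has exponent at least [N], so the
    monomial can be reduced.  A bound on the degree is used instead of one on each
    exponent because the exponents of bounded degree form a finite type. *)
Definition window : seq 'X_{1..m} := [seq val x | x : 'X_{1..m < (m * N).+1}].

Lemma mem_window a : (a \in window) = (mdeg a <= m * N)%N.
Proof.
apply/mapP/idP => [[x _ ->]|ha]; first by rewrite -ltnS bmdeg.
by exists (BMultinom (ha : mdeg a < (m * N).+1)%N); rewrite ?mem_enum.
Qed.

Lemma window_uniq : uniq window.
Proof. by rewrite map_inj_uniq ?enum_uniq //; apply: val_inj. Qed.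

(** The product of the [T - p_i] over the [N] values [p_i] of the [l]-th
    coordinate is a monic polynomial of degree [N] that vanishes at all of them. *)
Lemma eval_exp_relation l a :
  eval_exp (a + U_(l) *+ N)%MM \in
    <<[seq eval_exp (a + U_(l) *+ s)%MM | s <- iota 0 N]>>%VS.
Proof.
pose P := \prod_(i : 'I_N) ('X - (p i 0 l)%:P).
have sP : size P = N.+1.
  by rewrite size_prod_XsubC /index_enum -enumT size_enum_ord.
have P0 i : P.[p i 0 l] = 0.
  rewrite horner_prod (bigD1 i) //= hornerXsubC subrr mul0r //.
have E : \sum_(s < N.+1) P`_s *: eval_exp (a + U_(l) *+ s)%MM = 0.
  apply/rowP => i; rewrite summxE [RHS]mxE.
  transitivity (('X_[a]).@[fun h => p i 0 h] * P.[p i 0 l]).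
    rewrite horner_coef sP mulr_sumr; apply: eq_bigr => s _.
    by rewrite !mxE mpolyXD -mpolyXn mevalM rmorphXn /= mevalXU mulrCA.
  by rewrite P0 mulr0.
have mP : P`_N = 1.
  have := monic_prod_XsubC (index_enum 'I_N) xpredT (fun i => p i 0 l).
  by rewrite -/P monicE /lead_coef sP => /eqP.
move: E; rewrite big_ord_recr /= mP scale1r addrC => /eqP.
rewrite addr_eq0 => /eqP ->; rewrite rpredN.
apply: rpred_sum => s _; apply: rpredZ; apply: memv_span.
by apply/mapP; exists (val s); rewrite // mem_iota /=.
Qed.

(** The reduction replaces a monomial by divisors of it, which are smaller for
    every term order; hence an induction on the degree, and not along the order. *)
Lemma eval_exp_window a :
  eval_exp a \in <<[seq eval_exp b | b <- window & le b a]>>%VS.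
Proof.
have [d] := ubnP (mdeg a); elim: d a => // d IH a ltad.
case: (boolP (a \in window)) => [wa|].
  apply: memv_span; apply: map_f.
  by rewrite mem_filter wa (term_order_refl leT).
rewrite mem_window -ltnNge => big_a.
have [l Nl] : exists l, (N <= a l)%N.
  apply/existsP; apply: contraTT big_a; rewrite negb_exists => /forallP small.
  rewrite -leqNgt mdegE (@leq_trans (\sum_(i < m) N)%N) //.
    by apply: leq_sum => i _; apply: ltnW; rewrite ltnNge.
  by rewrite sum_nat_const card_ord.
pose a0 := (a - U_(l) *+ N)%MM.
have aE : a = (a0 + U_(l) *+ N)%MM.
  apply/mnmP => i; rewrite mnmDE mnmBE mulmnE mnm1E.
  by case: eqP => [<-|_]; rewrite ?mul1n ?subnK // mul0n subn0 addn0.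
rewrite {1}aE; apply: subvP (eval_exp_relation l a0).
apply/span_subvP => _ /mapP[s + ->]; rewrite mem_iota /= add0n => ltsN.
have ltsa : (mdeg (a0 + U_(l) *+ s)%MM < mdeg a)%N.
  by rewrite aE !mdegD !mdegMn mdeg1 !mul1n ltn_add2l.
apply: subvP (IH _ (leq_trans ltsa _)); last by rewrite -ltnS.
apply: sub_span => _ /mapP[b + ->]; rewrite mem_filter => /andP[leb wb].
apply: map_f; rewrite mem_filter wb andbT; apply: term_order_le_trans leb _ => //.
have -> : a = (a0 + U_(l) *+ s + U_(l) *+ (N - s))%MM.
  rewrite {1}aE; apply/mnmP => i; rewrite !mnmDE !mulmnE -addnA -mulnDr.
  by rewrite subnKC // ltnW.
exact: term_order_addr.
Qed.

Definition indep_of_smaller a : bool :=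
  eval_exp a \notin <<[seq eval_exp b | b <- window & strict le b a]>>%VS.

(** Leading exponents are linear dependences: a polynomial of the ideal with
    leading exponent [a] expresses the function [X^a] by smaller monomials, and
    conversely.  By [eval_exp_window] the smaller monomials may be taken in the
    window, which makes the condition decidable. *)
Lemma std_expsP a :
  std_exps le (aff_ideal (range p)) a <->
  (a \in window) && indep_of_smaller a.
Proof.
have idealP f : aff_ideal (range p) f <-> eval_points f = 0.
  split=> [fI|E _ [i _ <-]]; last by move/rowP/(_ i): E; rewrite !mxE.
  by apply/rowP => i; rewrite !mxE; apply: fI; exists i.
split=> [std_a|/andP[_ /negP ind] [f [/idealP f0 _ [fa lead]]]]; last first.
  (* Solve f = 0, as a function on the points, for the monomial X^a. *)
  apply: ind.
  have : eval_exp a =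
      - (f@_a)^-1 *: \sum_(b <- rem a (msupp f)) f@_b *: eval_exp b.
    move: f0; rewrite eval_pointsE (big_rem a) //= => /eqP.
    rewrite addr_eq0 => /eqP E; rewrite scaleNr -scalerN -E scalerA.
    by rewrite mulVf ?scale1r // -mcoeff_msupp.
  move->; apply: rpredZ; rewrite big_seq; apply: rpred_sum => b.
  rewrite (mem_rem_uniq _ (msupp_uniq f)) inE /= => /andP[ba /lead leb].
  apply: rpredZ; apply: subvP (eval_exp_window b); apply: sub_span.
  move=> _ /mapP[c + ->]; rewrite mem_filter => /andP[lec wc].
  apply: map_f; rewrite mem_filter wc andbT.
  by apply: (le_strict_trans leT lec); rewrite /strict ba.
have ind : indep_of_smaller a.
  apply/negP => /span_eval_exp[f fs E]; apply: std_a.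
  have lef b : b \in msupp f -> strict le b a.
    by move/fs; rewrite mem_filter => /andP[].
  have a_notin : a \notin msupp f.
    by apply/negP => /lef; rewrite strictE // (term_order_refl leT).
  have lead : is_lead_exp le ('X_[a] - f) a.
    split.
      rewrite mcoeff_msupp mcoeffB mcoeffX eqxx (memN_msupp_eq0 a_notin).
      by rewrite subr0 oner_neq0.
    move=> b /msuppB_le; rewrite mem_cat msuppX inE => /orP[/eqP ->|/lef].
      exact: (term_order_refl leT).
    by case/andP.
  exists ('X_[a] - f); split=> //; last exact: is_lead_exp_neq0 lead.
  by apply/idealP; rewrite linearB /= E subrr.
rewrite ind andbT; apply: contraT => wa; case/negP: ind.
apply: subvP (eval_exp_window a); apply: sub_span => _ /mapP[b + ->].
rewrite mem_filter => /andP[leb wb]; apply: map_f.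
rewrite mem_filter wb andbT /strict leb andbT.
by apply: contraNneq wa => <-.
Qed.

(** On a decreasing sequence this scans the monomials upwards and retains those
    that enlarge the span. *)
Definition greedy (s : seq 'X_{1..m}) : seq 'X_{1..m} :=
  [seq a <- s | eval_exp a \notin
                  <<[seq eval_exp b | b <- s & strict le b a]>>%VS].

Lemma greedy_basis (s : seq 'X_{1..m}) :
    pairwise (fun a b => strict le b a) s ->
  free [seq eval_exp a | a <- greedy s] /\
  <<[seq eval_exp a | a <- greedy s]>>%VS = <<[seq eval_exp a | a <- s]>>%VS.
Proof.
elim: s => [|a s IH] /=; first by rewrite nil_free.
move=> /andP[/allP as_ /IH[{IH} free_s span_s]].
have greedyE : greedy (a :: s) =
    if eval_exp a \notin <<[seq eval_exp b | b <- s]>>%VS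
    then a :: greedy s else greedy s.
  rewrite /greedy /=.
  have -> : strict le a a = false by rewrite /strict eqxx.
  have -> : [seq b <- s | strict le b a] = s by apply/all_filterP/allP.
  set g := filter _ s; suff -> : g = greedy s by [].
  apply: eq_in_filter => b /as_ ba; suff -> : strict le a b = false by [].
  by apply/negbTE; rewrite strictE // negbK; case/andP: ba.
rewrite greedyE; case: ifP => [ind|/negbFE dep] /=.
  by rewrite free_cons span_s ind free_s !span_cons span_s.
split=> //; rewrite span_cons span_s; apply/esym/addv_idPr.
by rewrite -memvE.
Qed.

(** Lagrange interpolation: for each [i], a product of linear factors, one for
    each other point, vanishes at the points other than the [i]-th one and not at
    the [i]-th one. *)
Lemma eval_points_full : injective p ->
  <<[seq eval_exp a | a <- window]>>%VS = fullv.
Proof.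
move=> p_inj; apply/eqP; rewrite eqEsubv subvf /=; apply/subvP => v _.
have sub f : eval_points f \in <<[seq eval_exp a | a <- window]>>%VS.
  apply: subvP (eval_points_span f); apply/span_subvP => _ /mapP[a _ ->].
  apply: subvP (eval_exp_window a); apply: sub_span => _ /mapP[b + ->].
  by rewrite mem_filter => /andP[_ wb]; apply: map_f.
rewrite (row_sum_delta v); apply: rpred_sum => i _; apply: rpredZ.
have sep j : exists g : {mpoly k[m]}, j != i ->
    g.@[fun l => p j 0 l] = 0 /\ g.@[fun l => p i 0 l] != 0.
  have [->|ji] := eqVneq j i; first by exists 0.
  have /existsP[l pl] : [exists l, p i 0 l != p j 0 l].
    apply: contraNT ji; rewrite negb_exists => /forallP E.
    apply/eqP/p_inj/rowP => l; move: (E l); rewrite negbK => /eqP ->.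
    by [].
  exists ('X_l - (p j 0 l)%:MP) => _.
  by rewrite !mevalB !mevalXU !mevalC subrr subr_eq0.
have [g gP] := fin_all_exists sep.
pose f := \prod_(j | j != i) g j.
have fi : f.@[fun l => p i 0 l] != 0.
  by rewrite rmorph_prod /=; apply/prodf_neq0 => j /gP[].
suff -> : delta_mx 0 i = (f.@[fun l => p i 0 l])^-1 *: eval_points f.
  by rewrite rpredZ.
apply/rowP => j; rewrite !mxE /=; have [->|ji] := eqVneq j i.
  by rewrite mulVf.
suff -> : f.@[fun l => p j 0 l] = 0 by rewrite mulr0.
by rewrite rmorph_prod /= (bigD1 j) //=; case: (gP j ji) => -> _; rewrite mul0r.
Qed.

(** The standard exponents are the greedy basis of the space of functions on the
    points, a space of dimension [N]. *)
Lemma card_std_exps_points : injective p ->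
  std_exps le (aff_ideal (range p)) #= `I_N.
Proof.
move=> p_inj.
pose s := sort (fun a b => le b a) window.
have s_mem : s =i window by apply: mem_sort.
have ge_trans : transitive (fun a b => le b a).
  by move=> b a c ba cb; apply: (term_order_le_trans leT cb ba).
have s_desc : pairwise (fun a b => strict le b a) s.
  have : pairwise (fun a b => le b a) s.
    rewrite -sorted_pairwise //; apply: sort_sorted => a b.
    exact: (term_order_total leT).
  have : pairwise (fun a b => a != b) s.
    by rewrite -uniq_pairwise sort_uniq window_uniq.
  move=> h1 h2; have : pairwise [rel a b | (a != b) && le b a] s.
    by rewrite pairwise_relI h1.
  by apply: sub_pairwise => a b; rewrite /strict /= eq_sym.
have [t_free t_span] := greedy_basis s_desc; set t := greedy s in t_free t_span.
have t_std : std_exps le (aff_ideal (range p)) = [set` t].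
  have span_s a : <<[seq eval_exp b | b <- s & strict le b a]>>%VS =
      <<[seq eval_exp b | b <- window & strict le b a]>>%VS.
    by apply/eq_span/eq_mem_map => b; rewrite !mem_filter s_mem.
  have tE a : (a \in t) = (a \in window) && indep_of_smaller a.
    by rewrite mem_filter s_mem span_s andbC.
  by apply/seteqP; split=> a; rewrite /= tE => /std_expsP.
have t_size : size t = N.
  move: t_free; rewrite /free t_span (eq_span (eq_mem_map _ s_mem)).
  rewrite eval_points_full // dimvf.
  by rewrite size_map => /eqP <-; exact: mul1n.
have t_uniq : uniq t by rewrite filter_uniq // sort_uniq window_uniq.
rewrite t_std -t_size.
have -> : [set` t] = nth 0%MM t @` `I_(size t).
  apply/seteqP; split=> [a /= ta|_ [i /= it <-]]; last exact: mem_nth.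
  by exists (index a t); rewrite /= ?index_mem ?nth_index.
apply: inj_card_eq => i j; rewrite !inE /= => it jt /eqP.
by rewrite nth_uniq // => /eqP.
Qed.

End Counting.

(** The number of standard exponents does not depend on the term order, which is
    what allows different orders on the affine exponents to be compared. *)
Lemma card_std_exps_aff (k : fieldType) (m : nat) (le : rel 'X_{1..m})
    (B : set 'rV[k]_m) : term_order le -> finite_set B ->
  std_exps le (aff_ideal B) #= B.
Proof.
move=> leT /finite_seqP[s0]; pose s := undup s0.
have -> : [set` s0] = [set` s].
  by apply/seteqP; split=> x /=; rewrite mem_undup.
move=> ->; pose p (i : 'I_(size s)) := nth 0 s i.
have p_inj : injective p.
  move=> i j /eqP; rewrite nth_uniq ?undup_uniq // => /eqP; exact: val_inj.
have -> : [set` s] = range p.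
  apply/seteqP; split=> [x /= xs|_ [i _ <-]]; last exact: mem_nth.
  have xs' : (index x s < size s)%N by rewrite index_mem.
  by exists (Ordinal xs'); rewrite // /p /= nth_index.
apply: card_eq_trans (card_std_exps_points leT p_inj) _.
apply: card_eq_trans card_II _; apply: card_esym; apply: inj_card_eq.
by move=> i j _ _ /p_inj.
Qed.

(** * Transport of polynomials along maps of exponents *)

Section Relabel.
Context (k : fieldType) (m m' : nat).
Context (S : pred 'X_{1..m}) (phi : 'X_{1..m} -> 'X_{1..m'}).
Implicit Types f : {mpoly k[m]}.

(** The common form of homogenisation, dehomogenisation, extension by leading
    zero coordinates and restriction to a coordinate subspace; in the last case
    [S] discards the monomials that vanish on the subspace. *)
Definition relabel f : {mpoly k[m']} :=
  \sum_(h <- msupp f | S h) f@_h *: 'X_[phi h].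

Lemma msupp_relabel f b :
  b \in msupp (relabel f) -> exists h, [/\ h \in msupp f, S h & b = phi h].
Proof.
move/msupp_sum_le/flattenP => [_ /mapP[h + ->]].
rewrite mem_filter => /andP[Sh fh] /msuppZ_le; rewrite msuppX inE.
by move=> /eqP ->; exists h.
Qed.

(** Injectivity is only asked on the monomials of [f] that are retained:
    dehomogenisation is injective on each form, but not on all exponents. *)
Lemma mcoeff_relabel f a :
    {in [pred h | (h \in msupp f) && S h] &, injective phi} ->
  a \in msupp f -> S a -> (relabel f)@_(phi a) = f@_a.
Proof.
move=> inj fa Sa; rewrite /relabel raddf_sum /=.
rewrite (big_rem a) //= Sa mcoeffZ mcoeffX eqxx mulr1 big_seq_cond big1 ?addr0 //.
move=> h /andP[+ Sh]; rewrite (mem_rem_uniq _ (msupp_uniq f)) inE => /andP[ha fh].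
rewrite mcoeffZ mcoeffX; case: eqP => [E|_]; last by rewrite mulr0.
by move: ha; rewrite (inj h a) ?eqxx // inE ?fh ?fa.
Qed.

Lemma is_lead_exp_relabel (le : rel 'X_{1..m}) (le' : rel 'X_{1..m'}) f a :
    {in [pred h | (h \in msupp f) && S h] &, injective phi} ->
    {in msupp f, forall h, S h -> le h a -> le' (phi h) (phi a)} ->
  S a -> is_lead_exp le f a -> is_lead_exp le' (relabel f) (phi a).
Proof.
move=> inj mono Sa [fa lead]; split.
  by rewrite mcoeff_msupp mcoeff_relabel // -mcoeff_msupp.
move=> _ /msupp_relabel[h [fh Sh ->]]; apply: mono => //; exact: lead.
Qed.

Lemma dhomog_relabel f d :
  {in msupp f, forall h, S h -> mdeg (phi h) = d} -> relabel f \is d.-homog.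
Proof. by move=> H; apply/dhomogP => _ /msupp_relabel[h [fh Sh ->]]; apply: H. Qed.

Lemma meval_relabel f (v : 'I_m -> k) (v' : 'I_m' -> k) :
    {in msupp f, forall h, ('X_[h] : {mpoly k[m]}).@[v] =
       if S h then ('X_[phi h] : {mpoly k[m']}).@[v'] else 0} ->
  (relabel f).@[v'] = f.@[v].
Proof.
move=> H; rewrite [in RHS](mpolyE f) /relabel !raddf_sum /= big_mkcond /=.
rewrite big_seq [RHS]big_seq; apply: eq_bigr => h fh.
by rewrite [RHS]mevalZ H //; case: ifP; rewrite ?mulr0 // mevalZ.
Qed.

End Relabel.

(** * Leading exponents of homogeneous vanishing ideals *)

Section ProjLead.
Context (k : fieldType) (n : nat).
Implicit Types (A : set (proj k n)) (f : {mpoly k[n.+1]}) (a : 'rV[k]_n.+1).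

Lemma homog_mdeg f d : f \is d.-homog -> {in msupp f, forall h, mdeg h = d}.
Proof. exact: dhomogP. Qed.

Lemma meval_homog_scale f d c a : f \is d.-homog ->
  f.@[fun i => (c *: a) 0 i] = c ^+ d * f.@[fun i => a 0 i].
Proof.
move=> /homog_mdeg hf; rewrite !mevalE mulr_sumr big_seq [RHS]big_seq.
apply: eq_bigr => h /hf <-; rewrite [RHS]mulrCA; congr (_ * _).
rewrite mdegE -prodrXr -big_split /=; apply: eq_bigr => i _.
by rewrite mxE exprMn.
Qed.

(** Restricted to the line through [a], the component of degree [d] of [f]
    becomes a multiple of [t ^ d], so different components do not interact. *)
Lemma coef_mmap_line f a d :
  (mmap (@polyC k) (fun i => a 0 i *: 'X) f)`_d =
  (pihomog mdeg d f).@[fun i => a 0 i].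
Proof.
rewrite /mmap coef_sum pihomogE raddf_sum /= [RHS]big_mkcond /=.
apply: eq_bigr => h _; rewrite /mmap1.
under eq_bigr do rewrite exprZn.
rewrite scaler_prod prodrXr -mdegE coefCM coefZ coefXn.
rewrite -[in LHS]mevalX eq_sym; case: eqP => _; last by rewrite !mulr0.
by rewrite mulr1 mevalZ.
Qed.

Definition vanishes A f :=
  forall P a, A P -> represents a P -> f.@[fun i => a 0 i] = 0.

Lemma proj_ideal_components A f :
  proj_ideal A f <-> forall d, vanishes A (pihomog mdeg d f).
Proof.
split=> H => [d P a AP aP|P a AP aP].
  by rewrite -coef_mmap_line (H P a AP aP) coef0.
by apply/polyP => d; rewrite coef_mmap_line coef0; apply: H AP aP.
Qed.

Lemma proj_ideal_homog A f d : f \is d.-homog -> vanishes A f -> proj_ideal A f.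
Proof.
move=> hf Af; apply/proj_ideal_components => e.
have [<-|/pihomog_ne0 ->//] := eqVneq d e; first by rewrite pihomog_dE.
by move=> P a _ _; rewrite meval0.
Qed.

Context (le : rel 'X_{1..n.+1}).

(** The leading exponents of the vanishing ideal for the graded order, witnessed by
    forms; the equivalence is [lead_exps_graded].  A form has all its exponents in
    one degree, so the ungraded order [le] is enough here. *)
Definition proj_lead A (g : 'X_{1..n.+1}) :=
  exists f, [/\ f \is (mdeg g).-homog, vanishes A f & is_lead_exp le f g].

(** The component of degree [mdeg g] of an element of the ideal with leading
    exponent [g] lies in the ideal, and still has leading exponent [g]. *)
Lemma lead_exps_graded A g :
  lead_exps (graded le) (proj_ideal A) g <-> proj_lead A g.
Proof.
split=> [[f [/proj_ideal_components If _ [fg lead]]]|[f [hf Af [fg lead]]]].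
  have coefE h : (pihomog mdeg (mdeg g) f)@_h = if mdeg h == mdeg g then f@_h else 0.
    rewrite pihomogE raddf_sum /= big_mkcond /=.
    under eq_bigr => b _ do rewrite mcoeffZ mcoeffX.
    case: (boolP (h \in msupp f)) => fh; last first.
      rewrite (memN_msupp_eq0 fh) if_same big_seq big1 // => b fb.
      case: (b =P h) fh => [<-|_ _]; last by rewrite mulr0 if_same.
      by rewrite fb.
    rewrite (big_rem h) //= eqxx mulr1 big_seq big1 ?addr0 // => b.
    rewrite (mem_rem_uniq _ (msupp_uniq f)) inE => /andP[/negbTE -> _].
    by rewrite mulr0 if_same.
  exists (pihomog mdeg (mdeg g) f); split=> //; first exact: pihomogP.
  split=> [|h]; rewrite mcoeff_msupp coefE ?eqxx -?mcoeff_msupp //.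
  case: ifP => [/eqP E|_]; rewrite ?eqxx // -mcoeff_msupp => /lead.
  by rewrite /graded E ltnn eqxx.
exists f; split=> //; first exact: proj_ideal_homog hf Af.
  by apply/negP => /eqP f0; move: fg; rewrite f0 msupp0.
split=> // h fh; rewrite /graded (homog_mdeg hf fh) eqxx ltnn.
exact: lead.
Qed.

Lemma proj_lead_add A g h : term_order le ->
  proj_lead A g -> proj_lead A (g + h)%MM.
Proof.
move=> leT [f [hf Af lf]]; exists (f * 'X_[h]); split.
- by rewrite mdegD; apply: dhomogM => //; rewrite dhomogX.
- by move=> P a AP aP; rewrite mevalM (Af P) // mul0r.
- by apply: is_lead_exp_mul => //; apply: is_lead_exp_mpolyX.
Qed.

Lemma represents_scale a b (P : proj k n) :
  represents a P -> represents b P -> exists c, a = c *: b.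
Proof.
move=> [_ aP] [b0 bP]; apply/vlineP; suff -> : <[b]>%VS = val P by [].
apply/eqP; rewrite eqEdim -memvE bP dim_vline b0 /=.
by have := valP P; rewrite /= => /eqP ->.
Qed.

Lemma represents_pick (P : proj k n) : represents (vpick (val P)) P.
Proof.
split; last exact: memv_pick.
rewrite vpick0; apply/negP => /eqP P0; have := valP P.
by rewrite P0 dimv0.
Qed.

(** The product of the hyperplanes [x_l = c x_i] for the ratios [c] in [s]. *)
Definition ratio_form (i l : 'I_n.+1) (s : seq k) : {mpoly k[n.+1]} :=
  \prod_(c <- s) ('X_l - c *: 'X_i).

Lemma ratio_form_homog i l s : ratio_form i l s \is (size s).-homog.
Proof.
rewrite /ratio_form; elim: s => [|c s IH]; first by rewrite big_nil dhomog1.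
rewrite big_cons /= -[(size s).+1]add1n; apply: dhomogM => //.
by rewrite rpredB ?rpredZ // dhomogX; apply/eqP; apply: mdeg1.
Qed.

Lemma ratio_form_lead i l s : term_order le -> strict le U_(i)%MM U_(l)%MM ->
  is_lead_exp le (ratio_form i l s) (U_(l) *+ size s)%MM.
Proof.
move=> leT /andP[il leil]; rewrite /ratio_form; elim: s => [|c s IH].
  rewrite big_nil mulm0n -mpolyX0; exact: is_lead_exp_mpolyX.
rewrite big_cons /= mulmS; apply: is_lead_exp_mul => //; split.
  rewrite mcoeff_msupp mcoeffB mcoeffZ !mcoeffX eqxx (negbTE il).
  by rewrite mulr0 subr0 oner_neq0.
move=> b /msuppB_le; rewrite mem_cat => /orP[|/msuppZ_le].
  by rewrite msuppX inE => /eqP ->; apply: (term_order_refl leT).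
by rewrite msuppX inE => /eqP ->.
Qed.

Lemma ratio_form_eq0 i l s a : a 0 i != 0 -> a 0 l / a 0 i \in s ->
  (ratio_form i l s).@[fun h => a 0 h] = 0.
Proof.
move=> ai sa; rewrite /ratio_form rmorph_prod /= (big_rem _ sa) /=.
by rewrite mevalB mevalZ !mevalXU divfK // subrr mul0r.
Qed.

(** A ratio of two coordinates does not depend on the representative, so the finite
    set [A] yields finitely many ratios. *)
Lemma finite_ratios A i l : finite_set A -> exists s : seq k,
  forall P a, A P -> represents a P -> a 0 i != 0 -> a 0 l / a 0 i \in s.
Proof.
pose r (P : proj k n) := vpick (val P) 0 l / vpick (val P) 0 i.
move=> /(finite_image r)/finite_seqP[s sE]; exists s => P a AP aP ai.
have [c aE] := represents_scale aP (represents_pick P).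
move: ai; rewrite aE !mxE mulf_eq0 negb_or => /andP[c0 _].
have : [set` s] (r P) by rewrite -sE; exists P.
by rewrite /= invfM mulrACA divff // mul1r.
Qed.

End ProjLead.

(** * Homogenisation with respect to the first variable *)

Section ExpCons.
Context (m : nat).
Implicit Types (a b : 'X_{1..m}) (c : 'X_{1..m.+1}).

Definition exp_tail c : 'X_{1..m} := [multinom c (lift ord0 i) | i < m].

Lemma exp_cons0_ord0 a : exp_cons0 a ord0 = 0%N.
Proof. by rewrite mnmE unlift_none. Qed.

Lemma exp_cons0_lift a i : exp_cons0 a (lift ord0 i) = a i.
Proof. by rewrite mnmE liftK. Qed.

Lemma exp_cons0K : cancel (@exp_cons0 m) exp_tail.
Proof. by move=> a; apply/mnmP => i; rewrite mnmE exp_cons0_lift. Qed.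

Lemma exp_cons0D a b : exp_cons0 (a + b)%MM = (exp_cons0 a + exp_cons0 b)%MM.
Proof.
apply/mnmP => i; rewrite mnmDE; case: (unliftP ord0 i) => [l|] ->.
  by rewrite !exp_cons0_lift mnmDE.
by rewrite !exp_cons0_ord0.
Qed.

Lemma exp_cons0_decomp c :
  c = (exp_cons0 (exp_tail c) + U_(ord0) *+ c ord0)%MM.
Proof.
apply/mnmP => i; rewrite mnmDE mulmnE mnm1E; case: (unliftP ord0 i) => [l|] ->.
  by rewrite exp_cons0_lift mnmE addn0.
by rewrite exp_cons0_ord0 eqxx mul1n.
Qed.

Lemma exp_tailK c : c ord0 = 0%N -> exp_cons0 (exp_tail c) = c.
Proof. by move=> c0; rewrite [RHS]exp_cons0_decomp c0 mulm0n addm0. Qed.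

Lemma exp_cons0UK a t : exp_tail (exp_cons0 a + U_(ord0) *+ t)%MM = a.
Proof.
by apply/mnmP => i; rewrite mnmE mnmDE exp_cons0_lift mulmnE mnm1E addn0.
Qed.

Lemma mdeg_exp_cons0 a : mdeg (exp_cons0 a) = mdeg a.
Proof.
rewrite !mdegE big_ord_recl exp_cons0_ord0 add0n.
by apply: eq_bigr => i _; rewrite exp_cons0_lift.
Qed.

Lemma mdeg_exp_cons0U a t : mdeg (exp_cons0 a + U_(ord0) *+ t)%MM = (mdeg a + t)%N.
Proof. by rewrite mdegD mdegMn mdeg1 mul1n mdeg_exp_cons0. Qed.

Lemma mdeg_exp_tail c : mdeg c = (mdeg (exp_tail c) + c ord0)%N.
Proof. by rewrite {1}[c]exp_cons0_decomp mdeg_exp_cons0U. Qed.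

Context (k : fieldType).
Implicit Types (x : 'rV[k]_m).

Lemma cons1_ord0 x : cons1 x 0 ord0 = 1.
Proof. by rewrite mxE; case: splitP => // i _; rewrite [i]ord1 mxE. Qed.

Lemma cons1_lift x i : cons1 x 0 (lift ord0 i) = x 0 i.
Proof.
rewrite mxE; case: splitP => l /= E; first by move: E; rewrite [l]ord1.
by congr (x 0 _); apply: val_inj; case: E.
Qed.

Lemma meval_cons1 c x :
  ('X_[c] : {mpoly k[m.+1]}).@[fun i => cons1 x 0 i] =
  ('X_[exp_tail c] : {mpoly k[m]}).@[fun i => x 0 i].
Proof.
rewrite !mevalX big_ord_recl cons1_ord0 expr1n mul1r.
by apply: eq_bigr => i _; rewrite cons1_lift mnmE.
Qed.

Lemma cons1_neq0 x : cons1 x != 0.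
Proof.
apply/eqP => /rowP /(_ ord0); rewrite cons1_ord0 mxE => /eqP.
by rewrite oner_eq0.
Qed.

Lemma line_exists (v : 'rV[k]_m.+1) : v != 0 -> exists P : proj k m, represents v P.
Proof.
move=> v0; have dimv : \dim <[v]>%VS == 1%N by rewrite dim_vline v0.
by exists (exist _ <[v]>%VS dimv); split=> //=; apply: memv_line.
Qed.

(** For a form, one representative of each line is enough. *)
Lemma vanishes_lines (B : set 'rV[k]_m) (f : {mpoly k[m.+1]}) d :
    f \is d.-homog ->
  vanishes (lines_through B) f <->
  (forall x, B x -> f.@[fun i => cons1 x 0 i] = 0).
Proof.
move=> hf; split=> [H b Bb|H P a [b Bb bP] aP].
  have [P bP] := line_exists (cons1_neq0 b).
  by apply: (H P) => //; exists b.
have [c ->] := represents_scale aP bP.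
by rewrite (meval_homog_scale _ _ hf) H // mulr0.
Qed.

End ExpCons.

Section Dehomogenisation.
Context (m : nat) (le : rel 'X_{1..m.+1}) (leT : term_order le).
Context (le_vars : forall i : 'I_m, le U_(ord0)%MM U_(lift ord0 i)%MM).
Implicit Types (a b : 'X_{1..m}).

(** This compares [x_0 ^ |b| X^a] with [x_0 ^ |a| X^b], two monomials of the same
    degree.  In general it is not the order induced by [le] on the exponents
    without [x_0]: when monomials are compared by weight, with weights 2, 4, 7 for
    the variables [x_0 < x < y], one has [y < x ^ 2] but [x_0 x ^ 2 < x_0 ^ 2 y]. *)
Definition dehom_le : rel 'X_{1..m} := fun a b =>
  le (exp_cons0 a + U_(ord0) *+ mdeg b)%MM (exp_cons0 b + U_(ord0) *+ mdeg a)%MM.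

(** Only the difference of the two powers of the first variable matters. *)
Lemma le_shift a b s t s' t' : (s + t' = s' + t)%N ->
  le (exp_cons0 a + U_(ord0) *+ s')%MM (exp_cons0 b + U_(ord0) *+ t')%MM ->
  le (exp_cons0 a + U_(ord0) *+ s)%MM (exp_cons0 b + U_(ord0) *+ t)%MM.
Proof.
move=> E /(term_order_mul leT (U_(ord0) *+ (s + t'))%MM).
rewrite -!addmA -!mulmnD.
have -> : (s' + (s + t') = s + (s' + t'))%N by lia.
have -> : (t' + (s + t') = t + (s' + t'))%N by lia.
by rewrite (mulmnD _ s) (mulmnD _ t) !addmA; apply: (term_order_cancel leT).
Qed.

Lemma dehom_le_homog a b s t : (mdeg a + s = mdeg b + t)%N ->
  dehom_le a b = le (exp_cons0 a + U_(ord0) *+ s)%MM (exp_cons0 b + U_(ord0) *+ t)%MM.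
Proof.
by move=> E; apply/idP/idP => h; apply: le_shift h; lia.
Qed.

(** The hypothesis that the first variable is the smallest is what makes [0]
    minimal for [dehom_le]. *)
Lemma le_U0_mdeg b : le (U_(ord0) *+ mdeg b)%MM (exp_cons0 b).
Proof.
have -> : exp_cons0 b = (\sum_(i < m) U_(lift ord0 i) *+ b i)%MM.
  apply/mnmP => i; rewrite mnm_sumE; case: (unliftP ord0 i) => [l|] ->.
    rewrite exp_cons0_lift (bigD1 l) //= mulmnE mnm1E eqxx mul1n big1 ?addn0 //.
    move=> l' l'l; rewrite mulmnE mnm1E (inj_eq lift_inj).
    by rewrite (negbTE l'l).
  by rewrite exp_cons0_ord0 big1 // => l _; rewrite mulmnE mnm1E.
rewrite mdegE; elim/big_rec2: _ => [|i c d _ IH].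
  by rewrite mulm0n; apply: (term_order_refl leT).
rewrite mulmnD; apply: (term_order_add leT) => //.
elim: (b i) => [|e IHe]; first by rewrite !mulm0n; apply: (term_order_refl leT).
by rewrite !mulmS; apply: (term_order_add leT).
Qed.

(** All the exponents that have to be compared are brought to one common degree,
    where [dehom_le] is [le]. *)
Lemma dehom_le_term_order : term_order dehom_le.
Proof.
split=> [a|a b|b a c ab bc|a b|a b c|b].
- exact: (term_order_refl leT).
- case/andP => ab ba; rewrite -[a](exp_cons0UK _ (mdeg b)).
  by rewrite (term_order_eq leT ab ba) exp_cons0UK.
- rewrite (@dehom_le_homog _ _ (mdeg b + mdeg c) (mdeg a + mdeg b)); last by lia.
  have ab' : le (exp_cons0 a + U_(ord0) *+ (mdeg b + mdeg c))%MM
                (exp_cons0 b + U_(ord0) *+ (mdeg a + mdeg c))%MM.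
    by rewrite -dehom_le_homog //; lia.
  have bc' : le (exp_cons0 b + U_(ord0) *+ (mdeg a + mdeg c))%MM
                (exp_cons0 c + U_(ord0) *+ (mdeg a + mdeg b))%MM.
    by rewrite -dehom_le_homog //; lia.
  exact: (term_order_le_trans leT ab').
- exact: (term_order_total leT).
- move=> ab; rewrite (@dehom_le_homog _ _ (mdeg b) (mdeg a)); last first.
    by rewrite !mdegD; lia.
  rewrite !exp_cons0D -!addmA ![(exp_cons0 c + _)%MM]addmC !addmA.
  exact: (term_order_mul leT).
- rewrite /dehom_le mdeg0 mulm0n addm0.
  have -> : exp_cons0 0%MM = 0%MM :> 'X_{1..m.+1}.
    by apply: (@addmI _ (exp_cons0 0%MM)); rewrite -exp_cons0D !addm0.
  by rewrite add0m; apply: le_U0_mdeg.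
Qed.

Context (k : fieldType) (B : set 'rV[k]_m).

(** From left to right set [x_0 = 1]; on the monomials of a form this loses no
    information.  From right to left homogenise in degree [msize f], which is larger
    than every degree occurring in [f]. *)
Lemma proj_lead_lines a :
  (exists t, proj_lead le (lines_through B) (exp_cons0 a + U_(ord0) *+ t)%MM) <->
  lead_exps dehom_le (aff_ideal B) a.
Proof.
split=> [[t [f [hf Bf lf]]]|[f [Bf _ lf]]].
  have degE := homog_mdeg hf; rewrite mdeg_exp_cons0U in degE.
  pose f' := relabel xpredT (@exp_tail m) f.
  have lf' : is_lead_exp dehom_le f' a.
    rewrite -[a](exp_cons0UK _ t); apply: is_lead_exp_relabel lf => //.
      move=> h h'; rewrite !inE !andbT => fh fh' E.
      rewrite [h]exp_cons0_decomp [h']exp_cons0_decomp E.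
      congr (_ + _ *+ _)%MM; apply/eqP.
      by rewrite -(eqn_add2l (mdeg (exp_tail h))) {2}E -!mdeg_exp_tail !degE.
    move=> h /degE hE _; rewrite {1}[h]exp_cons0_decomp exp_cons0UK.
    by rewrite -dehom_le_homog // -mdeg_exp_tail.
  exists f'; split=> //; last exact: is_lead_exp_neq0 lf'.
  move=> b Bb; rewrite (@meval_relabel _ _ _ _ _ _ (fun i => cons1 b 0 i)).
    exact: ((vanishes_lines B hf).1 Bf).
  by move=> h _ /=; rewrite meval_cons1.
pose d := msize f.
pose phi (h : 'X_{1..m}) := (exp_cons0 h + U_(ord0) *+ (d - mdeg h))%MM.
have degE h : h \in msupp f -> (mdeg h + (d - mdeg h) = d)%N.
  by move=> fh; rewrite subnKC // ltnW // msize_mdeg_lt.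
have fa : a \in msupp f by case: lf.
have hf : relabel xpredT phi f \is d.-homog.
  by apply: dhomog_relabel => h /degE hd _; rewrite mdeg_exp_cons0U.
exists (d - mdeg a)%N, (relabel xpredT phi f); split.
- by rewrite mdeg_exp_cons0U degE.
- apply/(vanishes_lines _ hf) => b Bb; rewrite -[RHS](Bf b Bb).
  by apply: meval_relabel => h _; rewrite meval_cons1 exp_cons0UK.
- apply: is_lead_exp_relabel lf => //.
    move=> h h' _ _ E; rewrite -[h](exp_cons0UK _ (d - mdeg h)) -/(phi h) E.
    by rewrite exp_cons0UK.
  by move=> h fh _; rewrite (@dehom_le_homog _ _ (d - mdeg h) (d - mdeg a)) // !degE.
Qed.

(** Unlike in [finite_ratios], the denominator [x_0] vanishes at no point: ratio
    forms with this denominator vanish on all the lines. *)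
Lemma finite_lines_ratios i : finite_set B -> exists s : seq k,
  forall P x, lines_through B P -> represents x P ->
    x 0 ord0 != 0 /\ x 0 i / x 0 ord0 \in s.
Proof.
move=> /(finite_image (fun y => cons1 y 0 i))/finite_seqP[s sE].
exists s => P x [b Bb bP] xP.
have [c xE] := represents_scale xP bP.
have c0 : c != 0 by apply: contra_neq xP.1 => c0; rewrite xE c0 scale0r.
have xlE l : x 0 l = c * cons1 b 0 l by rewrite xE mxE.
rewrite !xlE cons1_ord0 mulr1 mulrC mulKf //; split=> //.
by have : [set` s] (cons1 b 0 i) by rewrite -sE; exists b.
Qed.

End Dehomogenisation.

(** * Adding leading zero coordinates *)

Section Padding.
Context (n : nat) (j : 'I_n.+1).
Implicit Types (a b : 'X_{1..(n - j).+1}) (h : 'X_{1..n.+1}).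

Definition pad_ord (l : 'I_(n - j).+1) : 'I_n.+1 := inord (j + l).

Lemma val_pad_ord l : pad_ord l = (j + l)%N :> nat.
Proof. by rewrite inordK //; have := ltn_ord l; have := ltn_ord j; lia. Qed.

Lemma pad_ordK l : inord (pad_ord l - j) = l.
Proof. by rewrite val_pad_ord addKn inord_val. Qed.

Lemma pad_ord_inj : injective pad_ord.
Proof. by move=> l l' E; rewrite -[l]pad_ordK E pad_ordK. Qed.

Lemma pad_ord_surj (i : 'I_n.+1) : (j <= i)%N -> pad_ord (inord (i - j)) = i.
Proof.
move=> ji; apply: ord_inj; rewrite val_pad_ord inordK ?subnKC //.
by rewrite ltnS leq_sub2r // -ltnS.
Qed.

Lemma pad_ord0 : pad_ord ord0 = j.
Proof. by apply: ord_inj; rewrite val_pad_ord addn0. Qed.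

(** Used both for sums (degrees) and for products (values of monomials). *)
Lemma big_pad (R : Type) (idx : R) (op : Monoid.com_law idx) (F : 'I_n.+1 -> R) :
    (forall i : 'I_n.+1, (i < j)%N -> F i = idx) ->
  \big[op/idx]_i F i = \big[op/idx]_l F (pad_ord l).
Proof.
move=> F0; rewrite (bigID (fun i : 'I_n.+1 => (i < j)%N)) /= big1 // Monoid.mul1m.
rewrite (reindex_onto pad_ord (fun i => inord (i - j))) /=; last first.
  by move=> i; rewrite -leqNgt; apply: pad_ord_surj.
by apply: eq_bigl => l; rewrite pad_ordK eqxx val_pad_ord -leqNgt leq_addr.
Qed.

Lemma pad_ltn (V : nmodType) (v : 'I_(n - j).+1 -> V) (i : 'I_n.+1) :
  (i < j)%N -> pad v i = 0.
Proof. by rewrite /pad => ->. Qed.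

Lemma pad_pad_ord (V : nmodType) (v : 'I_(n - j).+1 -> V) l : pad v (pad_ord l) = v l.
Proof. by rewrite /pad pad_ordK val_pad_ord ltnNge leq_addr. Qed.

Definition exp_unpad h : 'X_{1..(n - j).+1} :=
  [multinom h (pad_ord l) | l < (n - j).+1].

Definition supp_from h : bool := [forall i : 'I_n.+1, (i < j)%N ==> (h i == 0%N)].

Lemma exp_padK : cancel (@exp_pad n j) exp_unpad.
Proof. by move=> a; apply/mnmP => l; rewrite !mnmE pad_pad_ord. Qed.

Lemma exp_pad_supp a : supp_from (exp_pad a).
Proof. by apply/forallP => i; apply/implyP => ij; rewrite mnmE pad_ltn. Qed.

Lemma exp_unpadK h : supp_from h -> exp_pad (exp_unpad h) = h.
Proof.
move=> /forallP h0; apply/mnmP => i; rewrite mnmE.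
case: (ltnP i j) => [ij|ji].
  by rewrite pad_ltn //; have /implyP/(_ ij)/eqP := h0 i.
by rewrite -(pad_ord_surj ji) pad_pad_ord mnmE.
Qed.

Lemma exp_padD a b : exp_pad (a + b)%MM = (exp_pad a + exp_pad b)%MM.
Proof.
by apply/mnmP => i; rewrite mnmDE !mnmE /pad; case: ifP => // _; rewrite mnmDE.
Qed.

Lemma exp_padU l t : exp_pad (U_(l) *+ t)%MM = (U_(pad_ord l) *+ t)%MM.
Proof.
apply/mnmP => i; rewrite mnmE mulmnE mnm1E; case: (ltnP i j) => [ij|ji].
  rewrite pad_ltn //; case: eqP => // E; move: ij.
  by rewrite -E val_pad_ord ltnNge leq_addr.
rewrite -{1}(pad_ord_surj ji) pad_pad_ord mulmnE mnm1E.
by rewrite -{2}(pad_ord_surj ji) (inj_eq pad_ord_inj).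
Qed.

Lemma exp_pad_head a : exp_pad a j = a ord0.
Proof.
by rewrite mnmE /pad ltnn subnn; congr (a _); apply: ord_inj; rewrite inordK.
Qed.

Lemma mdeg_exp_pad a : mdeg (exp_pad a) = mdeg a.
Proof.
rewrite !mdegE big_pad => [|i ij]; last by rewrite mnmE pad_ltn.
by apply: eq_bigr => l _; rewrite mnmE pad_pad_ord.
Qed.

Lemma exp_pad_line a t :
  exp_pad (a + U_(ord0) *+ t)%MM = (exp_pad a + U_(j) *+ t)%MM.
Proof. by rewrite exp_padD exp_padU pad_ord0. Qed.

Lemma exp_pad_axis a : @exp_pad n j @` axis ord0 a = axis j (exp_pad a).
Proof.
apply/seteqP; split=> [_ [_ [t _ <-] <-]|_ [t _ <-]].
  by exists t; rewrite // exp_pad_line.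
by exists (a + U_(ord0) *+ t)%MM; [exists t|rewrite exp_pad_line].
Qed.

Context (k : fieldType).

(** Restriction to the subspace where the first [j] coordinates vanish kills
    exactly the monomials that involve one of these coordinates. *)
Lemma meval_row_pad h (v : 'rV[k]_(n - j).+1) :
  ('X_[h] : {mpoly k[n.+1]}).@[fun i => row_pad v 0 i] =
  if supp_from h
  then ('X_[exp_unpad h] : {mpoly k[(n - j).+1]}).@[fun l => v 0 l] else 0.
Proof.
rewrite !mevalX; case: ifP => [/forallP h0|/negbT].
  rewrite big_pad => [|i ij].
    by apply: eq_bigr => l _; rewrite mxE pad_pad_ord mnmE.
  by have /implyP/(_ ij)/eqP -> := h0 i; rewrite expr0.
rewrite negb_forall => /existsP[i]; rewrite negb_imply => /andP[ij hi].
by rewrite (bigD1 i) //= mxE pad_ltn // expr0n (negbTE hi) mul0r.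
Qed.

Lemma graded_induced (le : rel 'X_{1..n.+1}) :
  induced_from j (graded le) = graded (induced_from j le).
Proof.
by apply/funext => a; apply/funext => b; rewrite /induced_from /graded /= !mdeg_exp_pad.
Qed.

(** A point of projective space has at most one representative with first nonzero
    coordinate 1, hence at most one element of the chart. *)
Lemma finite_chart (A : set (proj k n)) : finite_set A -> finite_set (chart A j).
Proof.
pose f (P : proj k n) : 'rV[k]_(n - j) :=
  \row_l (vpick (val P) 0 (pad_ord (lift ord0 l)) / vpick (val P) 0 j).
move=> /(finite_image f); apply: sub_finite_set => y [P AP yP]; exists P => //.
have [c cE] := represents_scale (represents_pick P) yP.
have padE l : vpick (val P) 0 (pad_ord l) = c * cons1 y 0 l.
  by rewrite cE [LHS]mxE [row_pad _ _ _]mxE pad_pad_ord.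
have c0 : c != 0.
  by apply: contra_neq (represents_pick P).1 => c0; rewrite cE c0 scale0r.
apply/rowP => l; rewrite mxE -[in X in _ / X]pad_ord0 !padE cons1_lift cons1_ord0.
by rewrite mulr1 mulrC mulKf.
Qed.

Lemma represents_chart (A : set (proj k n)) P (x : 'rV[k]_n.+1) :
    A P -> represents x P -> (forall i : 'I_n.+1, (i < j)%N -> x 0 i = 0) ->
    x 0 j != 0 ->
  exists2 y, chart A j y & x = x 0 j *: row_pad (cons1 y).
Proof.
move=> AP xP x0 xj.
pose y : 'rV[k]_(n - j) := \row_l (x 0 (pad_ord (lift ord0 l)) / x 0 j).
have xE : x = x 0 j *: row_pad (cons1 y).
  apply/rowP => i; rewrite [RHS]mxE [row_pad _ _ _]mxE.
  case: (ltnP i j) => [ij|ji]; first by rewrite x0 // pad_ltn // mulr0.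
  rewrite -(pad_ord_surj ji) pad_pad_ord.
  case: (unliftP ord0 (inord (i - j) : 'I_(n - j).+1)) => [l|] ->.
    by rewrite cons1_lift mxE mulrC divfK.
  by rewrite cons1_ord0 mulr1 pad_ord0.
exists y; last exact: xE.
exists P => //; split.
  by apply: contra_neq xP.1 => y0; rewrite xE y0 scaler0.
have -> : row_pad (cons1 y) = (x 0 j)^-1 *: x.
  by rewrite {2}xE scalerA mulVf // scale1r.
by apply: rpredZ; case: xP.
Qed.

End Padding.

(** * Axes of standard exponents *)

Section Axes.
Context (k : fieldType).

Lemma axis_sub_std (n : nat) (A : set (proj k n)) (le : rel 'X_{1..n.+1}) i g :
  axis i g `<=` std_exps (graded le) (proj_ideal A) <->
  forall t, ~ proj_lead le A (g + U_(i) *+ t)%MM.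
Proof.
split=> [H t /lead_exps_graded|H _ [t _ <-] /lead_exps_graded]; last exact: H.
by apply: H; exists t.
Qed.

Context (n : nat) (A : set (proj k n)) (finA : finite_set A).
Context (le : rel 'X_{1..n.+1}) (leT : term_order le).
Context (le_vars : forall i j : 'I_n.+1, (i < j)%N -> strict le U_(i)%MM U_(j)%MM).
Context (j : 'I_n.+1).

Let B := chart A j.
Let le_j := induced_from j le.

Lemma induced_from_term_order : term_order le_j.
Proof.
apply: term_order_relpre leT; first exact: exp_padD.
exact: can_inj (@exp_padK n j).
Qed.

Lemma induced_from_vars (l : 'I_(n - j).+1) :
  l != ord0 -> strict le_j U_(ord0)%MM U_(l)%MM.
Proof.
move=> l0; rewrite (strictE induced_from_term_order) /le_j /induced_from /=.
rewrite -[U_(l)%MM]mulm1n -[U_(ord0)%MM]mulm1n !exp_padU !mulm1n.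
rewrite -(strictE leT); apply: le_vars; rewrite pad_ord0 val_pad_ord.
by rewrite -[ltnLHS]addn0 ltn_add2l lt0n.
Qed.

Lemma induced_after_term_order : term_order (induced_after j le).
Proof.
apply: term_order_relpre induced_from_term_order; first exact: exp_cons0D.
exact: can_inj (@exp_cons0K (n - j)).
Qed.

(** Restriction to the subspace where the coordinates before [j] vanish keeps the
    leading monomial, which does not involve these coordinates. *)
Lemma proj_lead_unpad a :
  proj_lead le A (exp_pad a) -> proj_lead le_j (lines_through B) a.
Proof.
move=> [f [hf Af lf]]; have degE := homog_mdeg hf.
have hf' : relabel (supp_from j) (@exp_unpad n j) f \is (mdeg a).-homog.
  apply: dhomog_relabel => h fh Sh.
  by rewrite -mdeg_exp_pad exp_unpadK // degE // mdeg_exp_pad.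
exists (relabel (supp_from j) (@exp_unpad n j) f); split=> //.
  apply/(vanishes_lines _ hf') => y [P AP yP]; rewrite -[RHS](Af P _ AP yP).
  by apply: meval_relabel => h _; apply: meval_row_pad.
rewrite -[a](@exp_padK n j); apply: is_lead_exp_relabel lf.
- move=> h h'; rewrite !inE => /andP[_ Sh] /andP[_ Sh'] E.
  by rewrite -(exp_unpadK Sh) E exp_unpadK.
- move=> h fh Sh; rewrite /le_j /induced_from /= exp_unpadK //.
  by rewrite exp_unpadK // exp_pad_supp.
- exact: exp_pad_supp.
Qed.

(** One ratio form for each earlier coordinate.  Their leading exponents are all
    multiples of [e_j], because [X_i < X_j] for [i < j]. *)
Lemma earlier_charts_form (r : seq 'I_n.+1) : (forall i, i \in r -> (i < j)%N) ->
  exists f e, [/\ f \is e.-homog, is_lead_exp le f (U_(j) *+ e)%MM &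
    forall P x, A P -> represents x P -> has (fun i => x 0 i != 0) r ->
      f.@[fun i => x 0 i] = 0 :> k].
Proof.
elim: r => [|i r IH] rj.
  exists 1, 0%N; split=> //; first by rewrite dhomog1.
  by rewrite mulm0n -mpolyX0; apply: is_lead_exp_mpolyX.
have [|f [e [hf lf f0]]] := IH.
  by move=> i' ri'; apply: rj; rewrite inE ri' orbT.
have [s sP] := finite_ratios i j finA.
exists (ratio_form i j s * f), (size s + e)%N; split.
- by apply: dhomogM => //; apply: ratio_form_homog.
- rewrite mulmnD; apply: is_lead_exp_mul => //; apply: ratio_form_lead => //.
  by apply: le_vars; apply: rj; rewrite inE eqxx.
- move=> P x AP xP /orP[xi|xr]; rewrite mevalM; last by rewrite (f0 P) // mulr0.
  by rewrite ratio_form_eq0 ?mul0r //; apply: (sP P).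
Qed.

(** The factor [X_j] takes care of the later charts, the factor from
    [earlier_charts_form] of the earlier ones; on the chart of [j] itself the
    extended form vanishes by homogeneity. *)
Lemma proj_lead_pad a : proj_lead le_j (lines_through B) a ->
  exists t, proj_lead le A (exp_pad a + U_(j) *+ t)%MM.
Proof.
move=> [f [hf Bf lf]].
pose r := [seq i : 'I_n.+1 <- enum 'I_n.+1 | (i < j)%N].
have [|q [e [hq lq q0]]] := @earlier_charts_form r.
  by move=> i; rewrite mem_filter => /andP[].
pose F := relabel xpredT (@exp_pad n j) f.
have hF : F \is (mdeg a).-homog.
  by apply: dhomog_relabel => h fh _; rewrite mdeg_exp_pad (homog_mdeg hf).
exists e.+1, (F * ('X_j * q)); split.
- rewrite mdegD mdegMn mdeg1 mul1n mdeg_exp_pad -[e.+1]add1n.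
  apply: dhomogM => //; apply: dhomogM => //.
  by rewrite dhomogX; apply/eqP; apply: mdeg1.
- move=> P x AP xP; rewrite !mevalM mevalXU.
  have [xr|/hasPn xr] := boolP (has (fun i => x 0 i != 0) r).
    by rewrite (q0 P) // !mulr0.
  have [->|xj] := eqVneq (x 0 j) 0; first by rewrite mul0r mulr0.
  have [|y By xE] := represents_chart AP xP _ xj.
    by move=> i ij; apply/eqP; rewrite -[_ == _]negbK xr // mem_filter ij mem_enum.
  rewrite xE (meval_homog_scale _ _ hF) -/F.
  have -> : F.@[fun i => row_pad (cons1 y) 0 i] = f.@[fun l => cons1 y 0 l].
    by apply: meval_relabel => h _; rewrite meval_row_pad exp_pad_supp exp_padK.
  by rewrite ((vanishes_lines B hf).1 Bf) // mulr0 mul0r.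
- apply: (is_lead_exp_mul leT).
    apply: is_lead_exp_relabel lf => // h h' _ _ /(congr1 (@exp_unpad n j)).
    by rewrite !exp_padK.
  by rewrite mulmS; apply: is_lead_exp_mul => //; apply: is_lead_exp_mpolyX.
Qed.

(** [X_i] vanishes at the points with zero [i]-th coordinate, and a ratio form at
    all others. *)
Lemma proj_lead_earlier (h : 'X_{1..n.+1}) (i : 'I_n.+1) : (i < j)%N -> h i != 0%N ->
  exists t, proj_lead le A (h + U_(j) *+ t)%MM.
Proof.
move=> ij hi; have [s sP] := finite_ratios i j finA.
exists (size s).
have -> : (h + U_(j) *+ size s = (U_(i) + U_(j) *+ size s) + (h - U_(i)))%MM.
  apply/mnmP => l; rewrite !mnmDE mnmBE mnm1E; case: eqP => [<-|_]; lia.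
apply: proj_lead_add => //; exists ('X_i * ratio_form i j s); split.
- rewrite mdegD mdegMn !mdeg1 mul1n; apply: dhomogM; last exact: ratio_form_homog.
  by rewrite dhomogX; apply/eqP; apply: mdeg1.
- move=> P x AP xP; rewrite mevalM mevalXU.
  have [->|xi] := eqVneq (x 0 i) 0; first by rewrite mul0r.
  by rewrite ratio_form_eq0 ?mulr0 //; apply: (sP P).
- apply: is_lead_exp_mul => //; first exact: is_lead_exp_mpolyX.
  by apply: ratio_form_lead => //; apply: le_vars.
Qed.

(** No axis of standard exponents of a set of points off the hyperplane [x_0 = 0]
    goes in a direction other than that of [x_0]. *)
Lemma proj_lead_lines_other (l : 'I_(n - j).+1) a : l != ord0 ->
  exists t, proj_lead le_j (lines_through B) (a + U_(l) *+ t)%MM.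
Proof.
move=> l0; have [s sP] := finite_lines_ratios l (finite_chart j finA).
exists (size s); rewrite addmC; apply: (proj_lead_add _ induced_from_term_order).
exists (ratio_form ord0 l s); split.
- by rewrite mdegMn mdeg1 mul1n; apply: ratio_form_homog.
- by move=> P x BP xP; have [x0 xl] := sP P x BP xP; apply: ratio_form_eq0.
- apply: ratio_form_lead; first exact: induced_from_term_order.
  exact: induced_from_vars.
Qed.

Let std_j := std_exps (dehom_le le_j) (aff_ideal B).

Lemma axis_lines a : std_j a <->
  axis ord0 (exp_cons0 a) `<=`
    std_exps (graded le_j) (proj_ideal (lines_through B)).
Proof.
rewrite axis_sub_std; split=> [std_a t|H /proj_lead_lines[]].
  move=> lead_a; apply: std_a; apply/proj_lead_lines; last by exists t.
  exact: induced_from_term_order.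
- exact: induced_from_term_order.
- exact: H.
Qed.

Lemma axes_linesE :
  axes (std_exps (graded le_j) (proj_ideal (lines_through B))) =
  [set axis ord0 (exp_cons0 a) | a in std_j].
Proof.
apply/seteqP; split=> [_ [[i [g gi ->]] sub]|_ [a std_a <-]]; last first.
  split; last exact/axis_lines.
  by exists ord0; exists (exp_cons0 a); rewrite ?exp_cons0_ord0.
have [i0|i0] := eqVneq i ord0; last first.
  have [t] := proj_lead_lines_other g i0.
  by move/axis_sub_std: sub => /(_ t).
have gE : exp_cons0 (exp_tail g) = g by rewrite exp_tailK // -i0.
rewrite i0 in sub *; exists (exp_tail g); last by rewrite gE.
by apply/axis_lines; rewrite gE.
Qed.

Lemma axes_alongE :
  axes_along j (std_exps (graded le) (proj_ideal A)) =
  [set axis j (exp_pad (exp_cons0 a)) | a in std_j].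
Proof.
apply/seteqP; split=> [_ [[g gj ->] /axis_sub_std H]|_ [a std_a <-]].
  have Sg : supp_from j g.
    apply/forallP => i; apply/implyP => ij; apply: contraT => gi.
    by have [t /H] := proj_lead_earlier ij gi.
  have gE : exp_pad (exp_cons0 (exp_tail (exp_unpad j g))) = g.
    by rewrite exp_tailK ?exp_unpadK // mnmE pad_ord0.
  exists (exp_tail (exp_unpad j g)); last by rewrite gE.
  apply/axis_lines/axis_sub_std => t /proj_lead_pad[t'].
  by rewrite exp_pad_line gE -addmA -mulmnD => /H.
split; first by exists (exp_pad (exp_cons0 a)); rewrite // exp_pad_head exp_cons0_ord0.
apply/axis_sub_std => t; rewrite -exp_pad_line => /proj_lead_unpad.
by move/axis_lines/axis_sub_std: std_a; apply.
Qed.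

End Axes.

Theorem theorem3 (k : fieldType) (n : nat) (A : set (proj k n))
    (finA : finite_set A)
    (le : rel 'X_{1..n.+1}) (le_term : term_order le)
    (le_vars : forall i j : 'I_n.+1, (i < j)%N -> strict le U_(i)%MM U_(j)%MM)
    (j : 'I_n.+1) :
  let DA := std_exps (graded le) (proj_ideal A) in
  let Aj := chart A j in
  let DAj := std_exps (induced_after j le) (aff_ideal Aj) in
  let DclAj :=
    std_exps (induced_from j (graded le)) (proj_ideal (lines_through Aj)) in
  [/\ finite_set DAj,
      axes_along j DA #= DAj &
      axes_along j DA = [set (@exp_pad n j) @` S | S in axes DclAj]].
Proof.
move=> DA Aj DAj DclAj.
have finAj : finite_set Aj := finite_chart j finA.
have cardDAj : DAj #= Aj.
  by apply: card_std_exps_aff => //; apply: induced_after_term_order.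
split; first by rewrite (eq_finite_set cardDAj).
  (* The axes are counted by dehom_le, the set DAj by the induced order; both
     numbers are that of the points of Aj. *)
  rewrite axes_alongE //; apply: card_eq_trans (card_esym cardDAj).
  have leT := induced_from_term_order le_term j.
  apply: (card_eq_trans (inj_card_eq _)); last first.
    apply: card_std_exps_aff => //; apply: dehom_le_term_order => // l.
    by case/andP: (induced_from_vars le_term le_vars (isT : lift ord0 l != ord0)).
  (* An axis determines its base point: the base point of the second axis lies on
     the first one, and forgetting the direction coordinate identifies them. *)
  move=> a b _ _ E.
  have : axis j (exp_pad (exp_cons0 a)) (exp_pad (exp_cons0 b)).
    by rewrite E; exists 0%N; rewrite // mulm0n addm0.
  move=> [t _]; rewrite -exp_pad_line => /(can_inj (@exp_padK n j)).
  by move/(congr1 (@exp_tail _)); rewrite exp_cons0UK exp_cons0K.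
rewrite axes_alongE // /DclAj graded_induced axes_linesE //.
rewrite image_comp; congr image; apply/funext => a /=.
by rewrite exp_pad_axis.
Qed.
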